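(* For infinitely many $k\in\mathbb{N}$, there exists a bipartite graph with $k$ terminals which does not have a $\left(2-\epsilon,\ \epsilon^3k^2/150\right)$-rDAM, for any $1\ge\epsilon>0$.
   Context: Graphs $G=(V,E,\ell)$ are finite and undirected, with an edge length function $\ell:E\to\mathbb{R}^+$ and a designated set $T\subset V$ of $k$ vertices called terminals; the other vertices are non-terminals. $d_G$ is the shortest-path distance. A minor of $G$ is a graph obtained by a sequence of vertex deletions, edge deletions and edge contractions, where no terminal may be deleted and no two terminals may be contracted together (so every terminal survives; a super-node containing terminal $t$ is identified with $t$); a minor carries its own edge length function. A probability distribution $\pi$ over minors of $G$ is an $\alpha$-randomized distance approximating minor ($\alpha$-rDAM) of $G$ if for all $t,t'\in T$, $\mathbb{E}_{H\sim\pi}[d_H(t,t')]\le\alpha\cdot d_G(t,t')$, and for every minor $H$ in the support of $\pi$, $d_H(t,t')\ge d_G(t,t')$. It is an $(\alpha,y)$-rDAM if in addition every minor in the support of $\pi$ has at most $y$ non-terminals. *)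

(* Defs.v *)
From HB Require Import structures.
From mathcomp Require Import all_boot all_order all_algebra.
From mathcomp Require Import all_classical all_reals all_analysis.
From mathcomp Require Import measurable_realfun.

Set Implicit Arguments.
Unset Strict Implicit.
Unset Printing Implicit Defensive.

Import Order.TTheory GRing.Theory Num.Theory.

(* [verts] need not be all of V: V is an ambient finite set of vertex names, so
   that a graph and all its minors live over the same type. *)
Record graph (V : finType) := Graph {
  verts : {set V};
  edges : {set {set V}};
  edges_wf : [forall (e | e \in edges), (e \subset verts) && (#|e| == 2)]
}.

Section MinorOperations.
Variables (V : finType) (G : graph V).

Definition del_vertex_edges (x : V) : {set {set V}} :=
  [set e in edges G | x \notin e]%SET.

Lemma del_vertex_wf (x : V) :
  [forall (e | e \in del_vertex_edges x),
    (e \subset (verts G :\ x)%SET) && (#|e| == 2)].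
Proof.
apply/forall_inP => e; rewrite inE => /andP[eG xe].
have /andP[eV ->] := forall_inP (edges_wf G) e eG.
by rewrite andbT subsetD1 eV.
Qed.

Definition del_vertex (x : V) : graph V := Graph (del_vertex_wf x).

Lemma del_edge_wf (e0 : {set V}) :
  [forall (e | e \in (edges G :\ e0)%SET),
    (e \subset verts G) && (#|e| == 2)].
Proof.
apply/forall_inP => e; rewrite !inE => /andP[_ eG].
exact: (forall_inP (edges_wf G)).
Qed.

Definition del_edge (e0 : {set V}) : graph V := Graph (del_edge_wf e0).

Definition merge (u v x : V) : V := if x == v then u else x.

(* The cardinality test discards the loop created by the contracted edge;
   parallel edges are identified. *)
Definition contract_edges (u v : V) : {set {set V}} :=
  [set e in [set merge u v @: (e0 : {set V}) | e0 in edges G] | #|e| == 2]%SET.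

Lemma contract_wf (u v : V) :
  [forall (e | e \in contract_edges u v),
    (e \subset (merge u v @: verts G)%SET) && (#|e| == 2)].
Proof.
apply/forall_inP => e; rewrite inE => /andP[/imsetP[e0 e0G ->] ->].
have /andP[eV _] := forall_inP (edges_wf G) e0 e0G.
by rewrite andbT imsetS.
Qed.

(* The super-node {u, v} keeps the name u. *)
Definition contract (u v : V) : graph V := Graph (contract_wf u v).

End MinorOperations.

(* Since the vertex v merged into u is never a terminal, two terminals are never
   contracted together, and a super-node containing a terminal t is named t. *)
Inductive minor (V : finType) (T : {set V}) (G : graph V) : graph V -> Prop :=
| minor_refl : minor T G G
| minor_del_vertex (H : graph V) (x : V) :
    minor T G H -> x \notin T -> minor T G (del_vertex H x)
| minor_del_edge (H : graph V) (e : {set V}) :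
    minor T G H -> minor T G (del_edge H e)
| minor_contract (H : graph V) (u v : V) :
    minor T G H -> [set u; v]%SET \in edges H -> v \notin T ->
    minor T G (contract H u v).

Definition bipartite (V : finType) (G : graph V) : Prop :=
  exists A : {set V}, forall e, e \in edges G -> #|(e :&: A)%SET| = 1.

Local Open Scope classical_set_scope.
Local Open Scope ring_scope.

(* The values of [len] outside the edge set are irrelevant. *)
Record lgraph (R : realType) (V : finType) := LGraph {
  lgraph_graph :> graph V;
  len : {set V} -> R;
  len_gt0 : forall e, e \in edges lgraph_graph -> 0 < len e
}.

Section Distance.
Variables (R : realType) (V : finType) (G : lgraph R V).

Definition adj : rel V := fun x y => [set x; y]%SET \in edges G.

Fixpoint walk_len (x : V) (p : seq V) : R :=
  if p is y :: p' then len G [set x; y]%SET + walk_len y p' else 0.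

(* +oo when there is no path from x to y. *)
Definition dist (x y : V) : \bar R :=
  ereal_inf [set (walk_len x p)%:E | p in [set p | path adj x p /\ last x p = y]].

End Distance.

(* A distribution over minors is given as a random minor w |-> H w. The minors
   range over a non-discrete space because of their lengths, so "every minor in
   the support" is read as "almost surely". *)
Definition is_rDAM (R : realType) (V : finType) (T : {set V}) (G : lgraph R V)
    (alpha : R) (d : measure_display) (W : measurableType d)
    (P : probability W R) (H : W -> lgraph R V) : Prop :=
  (forall w, minor T G (H w)) /\
  forall t t', t \in T -> t' \in T ->
    [/\ measurable_fun [set: W] (fun w => dist (H w) t t'),
        (\int[P]_w dist (H w) t t' <= alpha%:E * dist G t t')%E
      & {ae P, forall w, (dist G t t' <= dist (H w) t t')%E}].

Definition has_rDAM (R : realType) (V : finType) (T : {set V}) (G : lgraph R V)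
    (alpha y : R) : Prop :=
  exists (d : measure_display) (W : measurableType d)
    (P : probability W R) (H : W -> lgraph R V),
    is_rDAM T G alpha P H /\
    {ae P, forall w, #|(verts (H w) :\: T)%SET|%:R <= y}.

(* Main.v *)
Require Import Defs.
From HB Require Import structures.
From mathcomp Require Import all_boot all_order all_algebra.
From mathcomp Require Import all_classical all_reals all_analysis.
From mathcomp Require Import measurable_realfun.
From mathcomp Require Import zify ring lra.

Set Implicit Arguments.
Unset Strict Implicit.
Unset Printing Implicit Defensive.

Import Order.TTheory GRing.Theory Num.Theory.
Local Open Scope classical_set_scope.
Local Open Scope ring_scope.

(* The graph is the incidence graph, with unit lengths, of a partial linear space
   on the terminals whose N blocks have size s: every block is a star with a
   non-terminal center, and two terminals have distance 2 if they share a block.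
   In a minor each star either keeps its center, or loses it to a deletion or to
   a contraction into a single terminal t. In the latter cases two terminals of
   the block other than t are no longer joined inside it, and since they share no
   other block, any path between them passes through a third terminal; domination
   then forces their distance up from 2 to at least 4. Summing over blocks and
   pairs and taking expectations, a (2 - eps, y)-rDAM requires
   eps N s <= 2 N + y (s - 2). The blocks are the lines i |-> a + b i over
   F_p, for i < s <= p, so that k = s p and N = p^2 = k^2 / s^2, with s ~ 4 / eps. *)

(** * Structure of the minors of an incidence graph *)

Section StarMinors.
Variables (X B : finType) (inc : B -> {set X}).
Local Notation V := (X + B)%type.

Definition terminals : {set V} := [set inl x | x : X]%SET.

Definition incidence_edges : {set {set V}} :=
  [set e : {set V} |
     [exists b, [exists x in inc b, e == [set inl x; inr b]]]]%SET.

Lemma incidence_edgesP e :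
  reflect (exists b x, x \in inc b /\ e = [set inl x; inr b]%SET)
          (e \in incidence_edges).
Proof.
rewrite inE; apply: (iffP existsP) => [[b /exists_inP[x xb /eqP ->]]|].
  by exists b, x.
by move=> [b [x [xb ->]]]; exists b; apply/exists_inP; exists x.
Qed.

Lemma incidence_wf :
  [forall (e | e \in incidence_edges),
    (e \subset [set: V]%SET) && (#|e| == 2)].
Proof.
apply/forall_inP => e /incidence_edgesP[b [x [_ ->]]].
by rewrite finset.subsetT cards2.
Qed.

Definition incidence_graph : graph V := Graph incidence_wf.

(* [f b] is the terminal into which the center of the vanished star [b] was
   contracted; it is arbitrary if that center was deleted. *)
Definition star_adj (H : graph V) (f : B -> X) (u v : V) : Prop :=
  match u, v with
  | inl x, inl y => exists b,
      [/\ inr b \notin verts H, x \in inc b, y \in inc b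
        & (f b == x) || (f b == y)]
  | inl x, inr b | inr b, inl x => x \in inc b
  | inr _, inr _ => False
  end.

(** Edges are bounded only from above and lengths are left free, so deletions preserve the property
    with the same [f]. *)
Definition star_minor (H : graph V) (f : B -> X) : Prop :=
  forall u v, [set u; v]%SET \in edges H -> star_adj H f u v.

Lemma edge_neq (W : finType) (G : graph W) (u v : W) :
  [set u; v]%SET \in edges G -> u != v.
Proof.
move=> /(forall_inP (edges_wf G))/andP[_]; rewrite cards2.
by case: (u != v).
Qed.

Lemma edge_vertl (W : finType) (G : graph W) (u v : W) :
  [set u; v]%SET \in edges G -> u \in verts G.
Proof.
move=> /(forall_inP (edges_wf G))/andP[/fintype.subsetP/(_ u) + _]; apply.
by rewrite !inE eqxx.
Qed.

Lemma contract_edgeP (W : finType) (G : graph W) (u v x y : W) :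
  [set x; y]%SET \in contract_edges G u v ->
  exists x0 y0, [/\ [set x0; y0]%SET \in edges G,
                    Defs.merge u v x0 = x & Defs.merge u v y0 = y].
Proof.
rewrite inE => /andP[/imsetP[e0 e0G eE] e2].
have /imsetP[x0 x0e xE] : x \in (Defs.merge u v @: e0)%SET.
  by rewrite -eE !inE eqxx.
have /imsetP[y0 y0e yE] : y \in (Defs.merge u v @: e0)%SET.
  by rewrite -eE !inE eqxx orbT.
exists x0, y0; split => //.
(* The image of [e0] still has two points, so their preimages are distinct and exhaust [e0]. *)
have xy : x != y by move: e2; rewrite cards2; case: (x != y).
have xy0 : x0 != y0 by apply: contraNneq xy => xy0; rewrite xE yE xy0.
suff -> : [set x0; y0]%SET = e0 by [].
apply/eqP; rewrite eqEcard cards2 xy0; apply/andP; split.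
  by apply/fintype.subsetP => z; rewrite !inE => /orP[] /eqP ->.
by have /andP[_ /eqP ->] := forall_inP (edges_wf G) e0 e0G.
Qed.

Lemma star_minor_sub (H K : graph V) (f : B -> X) :
  edges K \subset edges H -> verts K \subset verts H ->
  star_minor H f -> star_minor K f.
Proof.
move=> /fintype.subsetP sE /fintype.subsetP sV Hf u v /sE /Hf.
case: u v => [x|b] [y|c] //= [b [bH xb yb fb]].
by exists b; split => //; apply: contra bH; exact: sV.
Qed.

(** The edges from the center of [b] to its other terminals become edges from [x], which is what
    [star_adj] allows for a vanished star with value [x] at [b]. *)
Lemma star_minor_contract (H : graph V) (f : B -> X) (x : X) (b : B) :
  [set inl x; inr b]%SET \in edges H -> star_minor H f ->
  star_minor (Defs.contract H (inl x) (inr b)) (fun c => if c == b then x else f c).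
Proof.
move=> xbH Hf u v /contract_edgeP[u0 [v0 [uvH <- <-]]].
have bH : inr b \in verts H.
  by move: xbH; rewrite finset.setUC; exact: edge_vertl.
have xb : x \in inc b := Hf _ _ xbH.
have gone c : (c == b) || (inr c \notin verts H) ->
    inr c \notin verts (Defs.contract H (inl x) (inr b)).
  move=> cbH; apply/negP => /imsetP[z zH]; rewrite /Defs.merge.
  case: eqVneq => // zb zc; subst z.
  by move: cbH zb; rewrite zH orbF => /eqP ->; rewrite eqxx.
have := Hf _ _ uvH; rewrite /Defs.merge.
case: u0 v0 uvH => [y|c] [z|d] uvH //=.
- move=> [c [cH yc zc fc]]; exists c; split => //; first by rewrite gone ?cH ?orbT.
  (* A star that had already vanished is not [b], whose center is a vertex of [H], so its value of
     [f] is unchanged. *)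
  by case: (eqVneq c b) cH => [->|]; rewrite ?bH.
- case: (eqVneq (inr d) (inr b : V)) => [[->]|] // yb.
  by exists b; split => //; rewrite ?gone ?eqxx ?orbT.
- case: (eqVneq (inr c) (inr b : V)) => [[->]|] // yb.
  by exists b; split => //; rewrite ?gone ?eqxx.
Qed.

Lemma minor_star (H : graph V) (f0 : B -> X) :
  minor terminals incidence_graph H -> exists f, star_minor H f.
Proof.
elim=> {H} [|H v _ [f Hf] _|H e _ [f Hf]|H u v _ [f Hf] uv vT].
- exists f0 => u v /incidence_edgesP[b [x [xb uvE]]].
  have : u != v.
    by apply: (@edge_neq _ incidence_graph); apply/incidence_edgesP; exists b, x.
  have : u \in [set inl x; inr b]%SET by rewrite -uvE !inE eqxx.
  have : v \in [set inl x; inr b]%SET by rewrite -uvE !inE eqxx orbT.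
  by rewrite !inE => /orP[] /eqP -> /orP[] /eqP ->; rewrite ?eqxx.
- exists f; apply: star_minor_sub Hf; last exact: finset.subD1set.
  by apply/fintype.subsetP => e; rewrite inE => /andP[].
- by exists f; apply: star_minor_sub Hf => //; exact: finset.subD1set.
- case: v uv vT => [x _|b ub _]; first by rewrite imset_f.
  (* Two centers are never adjacent, so the contracted edge joins a center to a terminal. *)
  case: u ub => [x xb|c /Hf //].
  by eexists; exact: star_minor_contract xb Hf.
Qed.

End StarMinors.

(** * Walk lengths and distances *)

Section Walks.
Variables (R : realType) (V : finType) (G : lgraph R V).

Lemma walk_len_ge0 (x : V) (p : seq V) : path (adj G) x p -> 0 <= walk_len G x p.
Proof.
elim: p x => //= y p IHp x /andP[xy /IHp]; apply: addr_ge0.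
exact: ltW (len_gt0 xy).
Qed.

Lemma walk_len_cat (x : V) (p q : seq V) :
  walk_len G x (p ++ q) = walk_len G x p + walk_len G (last x p) q.
Proof. by elim: p x => [|y p IHp] x /=; rewrite ?add0r // IHp addrA. Qed.

Lemma dist_le_walk (x : V) (p : seq V) : path (adj G) x p ->
  (dist G x (last x p) <= (walk_len G x p)%:E)%E.
Proof. by move=> xp; apply: ereal_inf_lbound; exists p. Qed.

Lemma le_distP (x y : V) (r : R) :
  (forall p, path (adj G) x p -> last x p = y -> r <= walk_len G x p) ->
  (r%:E <= dist G x y)%E.
Proof. by move=> rxy; apply/ereal_infP => _ [p [xp py] <-]; rewrite lee_fin rxy. Qed.

Lemma dist_ge0 (x y : V) : (0 <= dist G x y)%E.
Proof. by apply: le_distP => p xp _; exact: walk_len_ge0. Qed.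

End Walks.

(** * Distances between terminals of a vanished star *)

Section Separation.
Variables (R : realType) (X B : finType) (inc : B -> {set X}).
Local Notation V := (X + B)%type.
Hypothesis inc_linear : forall (b c : B) (x y : X), x != y ->
  x \in inc b -> y \in inc b -> x \in inc c -> y \in inc c -> b = c.

(* A walk avoiding all other terminals would join [x] to [y] either by one edge,
   created by a contracted star, or through one surviving center; both stars
   would have to be [b]. *)
Lemma walk_meets_terminal (H : lgraph R V) (f : B -> X) (b : B) (x y : X)
    (p : seq V) :
  star_minor inc H f -> inr b \notin verts H ->
  x \in inc b -> y \in inc b -> x != y -> f b != x -> f b != y ->
  path (adj H) (inl x) p -> last (inl x) p = inl y ->
  exists z, [/\ z != x, z != y & inl z \in p].
Proof.
move=> Hf bH xb yb xy fx fy xp py; apply: contrapT => no_z.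
have {no_z} p_xy z : inl z \in p -> z = x \/ z = y.
  move=> zp; have [->|zx] := eqVneq z x; first by left.
  by have [->|zy] := eqVneq z y; [right | case: no_z; exists z].
(* The induction also allows walks that start at a surviving center of a block through [x]: only
   these vertices and [x] itself can be reached before another terminal is met. *)
have : exists2 u : V, path (adj H) u p /\ last u p = inl y &
    u = inl x \/ (exists2 c, x \in inc c & u = inr c /\ inr c \in verts H).
  by exists (inl x); last left.
elim: p p_xy {xp py} => [|v p IHp] p_xy [u [/= up uy] ux].
  by move: ux xy; rewrite uy => -[[->]|[c _ [//]]]; rewrite eqxx.
move: up => /andP[uv vp]; have Kuv := Hf _ _ uv.
have {}IHp := IHp (fun z zp => p_xy z (mem_behead (s := v :: p) zp)).
have vx : v = inl x -> False by move=> vx; apply: IHp; exists v; [|left].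
case: ux => [uE|[c xc [uE cH]]]; subst u;
  case: v p_xy uv vp uy Kuv vx => [z|d] p_xy uv vp uy Kuv vx //=.
- have [zx|zy] := p_xy z (mem_head _ _); first by apply: vx; rewrite zx.
  subst z; case: Kuv => c [cH xc yc].
  by rewrite -(inc_linear xy xb yb xc yc) (negbTE fx) (negbTE fy).
- apply: IHp; exists (inr d) => //; right; exists d => //; split=> //.
  by move: uv; rewrite /adj finset.setUC; exact: edge_vertl.
- have [zx|zy] := p_xy z (mem_head _ _); first by apply: vx; rewrite zx.
  by subst z; move: bH; rewrite (inc_linear xy xb yb xc Kuv) cH.
Qed.

(** Cutting a walk at the third terminal it meets leaves two walks between distinct terminals, each
    of length at least [r]. *)
Lemma dist_contracted_star (H : lgraph R V) (f : B -> X) (b : B) (x y : X)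
    (r : R) :
  star_minor inc H f -> inr b \notin verts H ->
  (forall z w : X, z != w -> (r%:E <= dist H (inl z) (inl w))%E) ->
  x \in inc b -> y \in inc b -> x != y -> f b != x -> f b != y ->
  ((r + r)%:E <= dist H (inl x) (inl y))%E.
Proof.
move=> Hf bH Hr xb yb xy fx fy; apply: le_distP => p xp py.
have [z [zx zy zp]] := walk_meets_terminal Hf bH xb yb xy fx fy xp py.
case/splitPr: zp xp py => p1 p2; rewrite -cat_rcons cat_path last_cat last_rcons.
move=> /andP[xz zp2] p2y; rewrite walk_len_cat last_rcons lerD // -lee_fin.
  by rewrite (le_trans _ (dist_le_walk xz)) // last_rcons Hr // eq_sym.
by rewrite (le_trans _ (dist_le_walk zp2)) // p2y Hr.
Qed.

End Separation.

(** * Distances in the incidence graph itself *)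

Section IncidenceDistances.
Variables (R : realType) (X B : finType) (inc : B -> {set X}).
Local Notation V := (X + B)%type.

Definition incidence_lgraph : lgraph R V :=
  @LGraph R V (incidence_graph inc) (fun=> 1) (fun _ _ => ltr01).

Lemma incidence_edgeE (x : X) (b : B) :
  ([set inl x; inr b]%SET \in edges (incidence_graph inc)) = (x \in inc b).
Proof.
apply/incidence_edgesP/idP => [[c [y [yc /setP E]]]|xb]; last by exists b, x.
have := E (inl x); have := E (inr b); rewrite !inE !eqxx ?orbT /=.
by move=> /esym/eqP[->] /esym; rewrite orbF => /eqP[->].
Qed.

Lemma incidence_edgell (x y : X) :
  ([set inl x; inl y]%SET \in edges (incidence_graph inc)) = false.
Proof.
apply/negP => /incidence_edgesP[c [z [_ /setP /(_ (inr c))]]].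
by rewrite !inE eqxx orbT.
Qed.

Lemma incidence_bipartite : bipartite (incidence_graph inc).
Proof.
exists (terminals X B) => _ /incidence_edgesP[b [x [_ ->]]].
rewrite (_ : _ :&: _ = [set inl x])%SET ?cards1 //.
apply/setP => -[y|c]; rewrite !inE.
  by rewrite orbF imset_f ?andbT.
by rewrite /= (introF imsetP) ?andbF // => -[].
Qed.

Lemma dist_incidence_ge2 (x y : X) : x != y ->
  (2%:E <= dist incidence_lgraph (inl x) (inl y))%E.
Proof.
move=> xy; apply: le_distP => -[_ [xyE]|v [|w p]]; first by rewrite xyE eqxx in xy.
  by move=> /= /[swap] ->; rewrite /adj incidence_edgell.
move=> /= /and3P[_ _ wp] _; have := walk_len_ge0 wp; lra.
Qed.

Lemma dist_incidence_le2 (b : B) (x y : X) : x \in inc b -> y \in inc b ->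
  (dist incidence_lgraph (inl x) (inl y) <= 2%:E)%E.
Proof.
move=> xb yb.
have xy : path (adj incidence_lgraph) (inl x) [:: inr b; inl y].
  by rewrite /= /adj /= incidence_edgeE xb finset.setUC incidence_edgeE yb.
by have := dist_le_walk xy; rewrite /= addr0.
Qed.

End IncidenceDistances.

(** * Counting pairs of terminals *)

Section DistinctPairs.
Variable X : finType.

(** Pairs are ordered; the resulting factor 2 is common to both sides of the final comparison. *)
Definition dpairs (A : {set X}) : {set X * X} :=
  [set q in finset.setX A A | q.1 != q.2]%SET.

Lemma card_dpairs (A : {set X}) : #|dpairs A| = (#|A| * #|A|.-1)%N.
Proof.
have -> : dpairs A = (finset.setX A A :\: [set (x, x) | x in A])%SET.
  apply/setP => -[x y]; rewrite !inE /= andbC.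
  case: (boolP (x \in A)) => //= xA; last by rewrite !andbF.
  case: (boolP (y \in A)) => yA; rewrite ?andbF //= !andbT; congr negb.
  by apply/eqP/imsetP => [<-|[z _ [-> ->]] //]; exists x.
rewrite cardsD (finset.setIidPr _); last first.
  by apply/fintype.subsetP => _ /imsetP[x xA ->]; rewrite !inE /= xA.
rewrite cardsX card_imset; last by move=> x y [].
by rewrite -subn1 mulnBr muln1.
Qed.

Lemma dpairsS (A A' : {set X}) : A \subset A' -> dpairs A \subset dpairs A'.
Proof.
move=> /fintype.subsetP AA; apply/fintype.subsetP => q; rewrite !inE.
by case/andP=> /andP[/AA -> /AA ->] ->.
Qed.

End DistinctPairs.

(** * Averaging over blocks and pairs *)

Section NoRDAM.
Variables (R : realType) (X B : finType) (inc : B -> {set X}) (n : nat).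
Local Notation V := (X + B)%type.
Hypothesis inc_linear : forall (b c : B) (x y : X), x != y ->
  x \in inc b -> y \in inc b -> x \in inc c -> y \in inc c -> b = c.
Hypothesis inc_uniform : forall b, #|inc b| = n.+2.

(** Summing over a list, without a membership predicate, gives the form to which [ge0_integral_sum]
    and [emeasurable_sum] are applied. *)
Definition star_dist_sum (H : lgraph R V) (b : B) : \bar R :=
  (\sum_(q <- enum (dpairs (inc b))) dist H (inl q.1) (inl q.2))%E.

Definition surviving (H : lgraph R V) : {set B} := [set b | inr b \in verts H]%SET.

Lemma card_surviving (H : lgraph R V) :
  (#|surviving H| <= #|(verts H :\: terminals X B)%SET|)%N.
Proof.
rewrite -(card_imset (mem (surviving H)) (@inr_inj X B)).
apply/subset_leq_card/fintype.subsetP => _ /imsetP[b + ->]; rewrite !inE => ->.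
by rewrite andbT; apply/imsetP => -[].
Qed.

(** Each pair contributes at least 2 by domination, and 2 more if the center is gone and the pair
    avoids [f b]. *)
Lemma star_dist_sum_ge (H : lgraph R V) (f : B -> X) (b : B) :
  star_minor inc H f ->
  (forall x y : X, x != y -> (2%:E <= dist H (inl x) (inl y))%E) ->
  ((2 * (n.+2%:R * n.+1%:R) +
    2 * (n.+1%:R * n%:R) * (b \notin surviving H)%:R)%:E <= star_dist_sum H b)%E.
Proof.
move=> Hf H2; rewrite /star_dist_sum big_enum /surviving inE /=.
pose far := dpairs (inc b :\ f b)%SET.
have far_sub : far \subset dpairs (inc b) by apply: dpairsS; exact: finset.subD1set.
(* Only an inequality: [f b] may lie outside the block, for instance after a deletion. *)
have far_card : (n.+1 * n <= #|far|)%N.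
  have := cardsD1 (f b) (inc b); rewrite inc_uniform card_dpairs => cE.
  have : (n.+1 <= #|inc b :\ f b|)%N by case: (f b \in _) cE => /=; lia.
  by case: #|_| => // m nm; rewrite leq_mul.
apply: (@le_trans _ _ (\sum_(q in dpairs (inc b))
    (2 + 2 * ((q \in far) && (inr b \notin verts H))%:R)%:E)%E).
  rewrite sumEFin lee_fin big_split /= sumr_const card_dpairs inc_uniform /=.
  rewrite -[2 *+ _]mulr_natr natrM lerD2l -mulr_sumr -mulrA ler_pM2l //.
  case: (inr b \notin verts H); last by rewrite mulr0 sumr_ge0.
  rewrite mulr1 -natrM -natr_sum ler_nat (leq_trans far_card) //.
  under eq_bigr do rewrite andbT.
  rewrite -big_mkcondr /= sum1_card; apply: subset_leq_card.
  apply/fintype.subsetP => q qf; apply/andP; split=> //.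
  exact: (fintype.subsetP far_sub).
apply: lee_sum => q qb; case: andP => [[qf bH]|_].
  move: qf; rewrite !inE => /andP[/andP[/andP[xf xb] /andP[yf yb]] xy].
  rewrite mulr1; apply: (dist_contracted_star inc_linear Hf bH) => //.
    by rewrite eq_sym.
  by rewrite eq_sym.
by rewrite mulr0 addr0 H2 //; move: qb; rewrite inE => /andP[].
Qed.

(** Surviving centers are non-terminals, so at most [y] stars survive and at least [#|B| - y] of
    them earn the extra term. *)
Lemma sum_star_dist_ge (H : lgraph R V) (f : B -> X) (y : R) :
  star_minor inc H f ->
  (forall x y : X, x != y -> (2%:E <= dist H (inl x) (inl y))%E) ->
  #|(verts H :\: terminals X B)%SET|%:R <= y ->
  ((#|B|%:R * (2 * (n.+2%:R * n.+1%:R)) +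
    2 * (n.+1%:R * n%:R) * (#|B|%:R - y))%:E <= \sum_b star_dist_sum H b)%E.
Proof.
move=> Hf H2 Hy; apply: le_trans (lee_sum _ (fun b _ => star_dist_sum_ge b Hf H2)).
rewrite sumEFin lee_fin big_split /= sumr_const -(mulr_natl (2 * _)) lerD2l.
rewrite -mulr_sumr ler_wpM2l ?mulr_ge0 //.
rewrite -natr_sum -big_mkcond /= sum1_card.
rewrite lerBlDr; apply: le_trans (lerD (lexx _) Hy); rewrite -natrD ler_nat.
apply: leq_trans (leq_add (leqnn _) (card_surviving H)).
rewrite addnC -(cardC (mem (surviving H))) leq_add2l.
by apply: subset_leq_card; apply/fintype.subsetP => b; rewrite !inE.
Qed.

Theorem incidence_no_rDAM (eps y : R) : eps <= 2 ->
  2 * #|B|%:R + y * n%:R < eps * #|B|%:R * n.+2%:R ->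
  ~ has_rDAM (terminals X B) (incidence_lgraph R inc) (2 - eps) y.
Proof.
move=> eps2 small_y [d [W [P [H [[Hminor Hdist] Hy]]]]].
have termP (x : X) : inl x \in terminals X B by exact: imset_f.
have /fin_all_exists[f0 _] (b : B) : exists x, x \in inc b.
  by apply/finset.set0Pn; rewrite -card_gt0 inc_uniform.
(* [c1] bounds the total distance from below almost surely, [c2] bounds its expectation from above;
   the hypothesis on [y] says exactly that [c2 < c1]. *)
pose c1 : R := #|B|%:R * (2 * (n.+2%:R * n.+1%:R)) +
    2 * (n.+1%:R * n%:R) * (#|B|%:R - y).
pose c2 : R := #|B|%:R * ((2 - eps) * 2 * (n.+2%:R * n.+1%:R)).
have c2_ge0 : 0 <= c2 by rewrite !mulr_ge0 // subr_ge0.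
have c12 : c2 < c1.
  rewrite -subr_gt0 (_ : c1 - c2 = 2 * n.+1%:R *
      (eps * #|B|%:R * n.+2%:R - (2 * #|B|%:R + y * n%:R))).
    by rewrite mulr_gt0 ?subr_gt0 ?mulr_gt0.
  by rewrite /c1 /c2 -addn2 -addn1 !natrD; ring.
pose F (q : X * X) w := dist (H w) (inl q.1) (inl q.2).
have mF q : measurable_fun [set: W] (F q).
  by have [] := Hdist _ _ (termP q.1) (termP q.2).
have ub : (\int[P]_w (\sum_b star_dist_sum (H w) b) <= c2%:E)%E.
  rewrite ge0_integral_sum //=; last 2 first.
  - by move=> b; exact: (emeasurable_sum _ (h := F)).
  - by move=> b w _; apply: sume_ge0 => q _; exact: dist_ge0.
  have -> : c2%:E =
      (\sum_(b : B) \sum_(q in dpairs (inc b)) ((2 - eps) * 2)%:E)%E.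
    under eq_bigr do rewrite sumEFin sumr_const card_dpairs inc_uniform.
    rewrite sumEFin sumr_const /c2; congr EFin; rewrite -[RHS]mulr_natl.
    by congr (_ * _); rewrite -[RHS]mulr_natr natrM.
  apply: lee_sum => b _; rewrite ge0_integral_sum //=; last first.
    by move=> q w _; exact: dist_ge0.
  rewrite big_enum /=.
  apply: lee_sum => q; rewrite !inE => /andP[/andP[xb yb] xy].
  have [_ le_int _] := Hdist _ _ (termP q.1) (termP q.2).
  apply: (le_trans le_int); rewrite EFinM lee_wpmul2l ?lee_fin ?subr_ge0 //.
  exact: dist_incidence_le2 xb yb.
have lb : (c1%:E <= \int[P]_w (\sum_b star_dist_sum (H w) b))%E.
  have -> : c1%:E = (\int[P]_(w in [set: W]) (cst c1%:E) w)%E.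
    rewrite integral_cst; last exact: measurableT.
    by rewrite [X in (_ * X)%E](_ : _ = 1%E) ?mule1 //; exact: probability_setT.
  apply: ae_ge0_le_integral => //.
  - by move=> w _; rewrite lee_fin (le_trans c2_ge0 (ltW c12)).
  - move=> w _; apply: sume_ge0 => b _; apply: sume_ge0 => q _.
    exact: dist_ge0.
  - by apply: emeasurable_sum => b; exact: (emeasurable_sum _ (h := F)).
  (* Domination holds almost surely for each pair, hence for all of the finitely many pairs at
     once. *)
  have H2 : {ae P, forall w, forall q : X * X, q.1 != q.2 ->
      (2%:E <= dist (H w) (inl q.1) (inl q.2))%E}.
    apply: filter_forall => q; have [_ _] := Hdist _ _ (termP q.1) (termP q.2).
    by apply: filterS => w le_d xy; apply: le_trans le_d; exact: dist_incidence_ge2.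
  apply: filterS2 H2 Hy => w H2 Hy _.
  have [f Hf] := minor_star f0 (Hminor w).
  by apply: (sum_star_dist_ge Hf) Hy => x x' xx'; exact: (H2 (x, x')).
by have := le_trans lb ub; rewrite lee_fin leNgt c12.
Qed.

End NoRDAM.

(** * Lines over a prime field as blocks *)

Section Lines.
Variables (p s : nat).
Hypotheses (p_pr : prime p) (sp : (s <= p)%N).

Definition line (ab : 'F_p * 'F_p) : {set 'I_s * 'F_p} :=
  [set (i, ab.1 + ab.2 * i%:R) | i : 'I_s]%SET.

Lemma card_line (ab : 'F_p * 'F_p) : #|line ab| = s.
Proof. by rewrite card_imset ?card_ord // => i j [->]. Qed.

Lemma natr_Fp_inj (i j : 'I_s) : i%:R = j%:R :> 'F_p -> i = j.
Proof.
move=> ij; apply/val_inj => /=; have := congr1 (@nat_of_ord _) ij.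
rewrite !val_Fp_nat // !modn_small //; exact: leq_trans (ltn_ord _) sp.
Qed.

(** Distinct points of a line have distinct first coordinates, which stay distinct modulo [p]
    because [s <= p]; their difference is invertible and determines the slope, then the
    intercept. *)
Lemma line_linear (ab cd : 'F_p * 'F_p) (x y : 'I_s * 'F_p) : x != y ->
  x \in line ab -> y \in line ab -> x \in line cd -> y \in line cd -> ab = cd.
Proof.
case: ab cd => a b [c d] + /imsetP[i _ xE] /imsetP[j _ yE]; subst x y => /=.
move=> ijE /imsetP[i' _ /eqP]; rewrite xpair_eqE => /andP[/eqP <- /eqP /= iE].
move=> /imsetP[j' _ /eqP]; rewrite xpair_eqE => /andP[/eqP <- /eqP /= jE].
have ij : (i%:R - j%:R : 'F_p) != 0.
  by rewrite subr_eq0; apply: contraNneq ijE => /natr_Fp_inj ->.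
have bd : b = d.
  apply: (mulIf ij); transitivity (a + b * i%:R - (a + b * j%:R)); first by ring.
  by rewrite iE jE; ring.
by move: iE; rewrite bd => /addIr ->.
Qed.

End Lines.

(** * Choice of the parameters *)

Lemma infinite_nat_unbounded (A : set nat) :
  (forall m, exists2 k, (m < k)%N & A k) -> infinite_set A.
Proof.
move=> A_unb /finite_seqP[F AF].
have [k] := A_unb (\max_(i <- F) i)%N; rewrite AF /= => kF kA.
by move: kF; rewrite ltnNge leq_bigmax_seq.
Qed.

Theorem theorem3p7 (R : realType) (eps : R) (eps_gt0 : 0 < eps)
    (eps_le1 : eps <= 1) :
  infinite_set [set k : nat |
    exists (V : finType) (T : {set V}) (G : lgraph R V),
      [/\ T \subset verts G, #|T| = k, bipartite G
        & ~ has_rDAM T G (2 - eps) (eps ^+ 3 * k%:R ^+ 2 / 150)]].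
Proof.
apply: infinite_nat_unbounded => m.
(* With c := eps s in (4, 5] the bound to beat reads 2 + c^3 / 150 < c. *)
have [n] : exists n, 4 < eps * n.+2%:R <= 5.
  (* Take [n.+2] to be one more than the integer part of [4 / eps]: the product with [eps] exceeds 4
     and is at most [4 + eps <= 5]. *)
  have q_ge4 : 4 <= 4 / eps by rewrite ler_pdivlMr //; lra.
  have /andP[] := truncn_itv (le_trans (ler0n R 4) q_ge4).
  case: (Num.truncn (4 / eps)) => [|n le_q lt_q].
    by move=> _ ?; lra.
  exists n; move: le_q lt_q; rewrite ler_pdivlMr // ltr_pdivrMr // => le_q lt_q.
  by rewrite mulrC lt_q -natr1 mulrDl; lra.
set s := n.+2 => /andP[lt_s le_s].
(* With [s] fixed, [p] grows: [p > m] makes [k = s p] exceed [m], and [p > s] makes the lines a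
   linear space. *)
have [p p_gt p_pr] := prime_above (maxn m s).
move: p_gt; rewrite gtn_max => /andP[mp sp].
exists (s * p)%N; first by rewrite (leq_trans mp) // leq_pmull.
pose inc := @line p s.
exists ('I_s * 'F_p + 'F_p * 'F_p)%type, (terminals _ _).
exists (incidence_lgraph R inc).
split.
- exact: finset.subsetT.
- by rewrite card_imset; [rewrite card_prod card_ord card_Fp | exact: inl_inj].
- exact: incidence_bipartite.
apply: (@incidence_no_rDAM _ _ _ _ n).
- exact: line_linear (ltnW sp).
- exact: card_line.
- lra.
rewrite card_prod card_Fp // !natrM.
have p_gt0 : 0 < p%:R :> R by rewrite ltr0n prime_gt0.
have -> : eps ^+ 3 * (s%:R * p%:R) ^+ 2 / 150 * n%:R =
    p%:R ^+ 2 * ((eps * s%:R) ^+ 2 * (eps * n%:R) / 150) :> R by field.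
have -> : eps * (p%:R * p%:R) * s%:R = p%:R ^+ 2 * (eps * s%:R) by ring.
rewrite -expr2 [2 * _]mulrC -mulrDr ltr_pM2l ?exprn_gt0 //.
have le_n : eps * n%:R <= 5.
  by apply: le_trans le_s; rewrite ler_pM2l // ler_nat /s; lia.
have n_ge0 : 0 <= eps * n%:R by rewrite mulr_ge0 // ltW.
(* After division by [p ^+ 2] the left side is at most [2 + 125 / 150], below [4 < eps * s]. *)
have : (eps * s%:R) ^+ 2 * (eps * n%:R) <= 25 * 5.
  by apply: ler_pM => //; [exact: sqr_ge0 | nra].
lra.
Qed.
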